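(* (Dual basis lemma) Let $\mathcal{C}$ be a small preadditive category. An object $P\in\mathrm{Mod}(\mathcal{C})$ is projective if and only if there exists a family of morphisms $\{\beta_{j}:P\to\mathrm{Hom}_{\mathcal{C}}(C_{j},-)\}_{j\in J}$ (with $C_j\in\mathcal{C}$) and a family $\{x_{j}\}_{j\in J}$ with $x_{j}\in P(C_{j})$ such that for all $X\in\mathcal{C}$ and for every $a\in P(X)$ there exists a finite subset $J_{X,a}\subseteq J$ such that $$a=\sum_{j\in J_{X,a}}P([\beta_{j}]_{X}(a))(x_{j}).$$
   Context: $\mathrm{Mod}(\mathcal{C})$ is the category of additive covariant functors $\mathcal{C}\to\mathbf{Ab}$. For a morphism $\beta_j:P\to\mathrm{Hom}_{\mathcal{C}}(C_j,-)$, $[\beta_j]_X:P(X)\to\mathrm{Hom}_{\mathcal{C}}(C_j,X)$ denotes its component at $X$, so $[\beta_j]_X(a):C_j\to X$ and $P([\beta_j]_X(a)):P(C_j)\to P(X)$.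
   Formalization: The finite subset J_{X,a} is also required to contain every j with [β_j]_X(a) ≠ 0; without this the ''if'' direction fails, e.g. for C = ℤ (one object) and P = ℤ^ℕ, which is not projective but satisfies the displayed condition. *)

(* Defs.v *)
From HB Require Import structures.
From mathcomp Require Import all_boot ssralg finmap.
From mathcomp Require Import boolp.

Set Implicit Arguments.
Unset Strict Implicit.
Unset Printing Implicit Defensive.

Import GRing.Theory.
Local Open Scope ring_scope.

(* Abelian groups are modelled by [zmodType].  The extra choice structure that
   it carries costs nothing classically, and morphisms do not have to respect
   it.  Smallness of the category is the fact that its objects form a type. *)
Record preadditiveCat := PreadditiveCat {
  ob :> Type;
  mor : ob -> ob -> zmodType;
  idm : forall X : ob, mor X X;
  compm : forall X Y Z : ob, mor Y Z -> mor X Y -> mor X Z;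
  compm1l : forall (X Y : ob) (f : mor X Y), compm (idm Y) f = f;
  compm1r : forall (X Y : ob) (f : mor X Y), compm f (idm X) = f;
  compmA : forall (X Y Z W : ob) (h : mor Z W) (g : mor Y Z) (f : mor X Y),
    compm h (compm g f) = compm (compm h g) f;
  compmDl : forall (X Y Z : ob) (g g' : mor Y Z) (f : mor X Y),
    compm (g + g') f = compm g f + compm g' f;
  compmDr : forall (X Y Z : ob) (g : mor Y Z) (f f' : mor X Y),
    compm g (f + f') = compm g f + compm g f'
}.

Arguments mor {_} _ _.
Arguments idm {_} _.
Arguments compm {_ _ _ _} _ _.

(* The objects of Mod(C): additive covariant functors from C to Ab. *)
Record cmod (C : preadditiveCat) := CMod {
  fob :> C -> zmodType;
  fmap : forall X Y : C, mor X Y -> {additive fob X -> fob Y};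
  fmap_id : forall (X : C) (a : fob X), fmap (idm X) a = a;
  fmap_comp : forall (X Y Z : C) (g : mor Y Z) (f : mor X Y) (a : fob X),
    fmap (compm g f) a = fmap g (fmap f a);
  fmapD : forall (X Y : C) (f f' : mor X Y) (a : fob X),
    fmap (f + f') a = fmap f a + fmap f' a
}.

Arguments fmap {_} _ {_ _} _.

(* The morphisms of Mod(C): natural transformations. *)
Record nattrans (C : preadditiveCat) (M N : cmod C) := NatTrans {
  component :> forall X : C, {additive M X -> N X};
  naturality : forall (X Y : C) (f : mor X Y) (a : M X),
    component Y (fmap M f a) = fmap N f (component X a)
}.

Lemma additive_ext (U V : zmodType) (f g : {additive U -> V}) :
  f =1 g -> f = g.
Proof.
case: f g => [f [[fN]]] [g [[gN]]] /= fg.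
have {}fg : f = g.
  by apply: functional_extensionality_dep => x; exact: fg.
by move: fN gN; rewrite fg => fN gN; rewrite (Prop_irrelevance fN gN).
Qed.

Lemma nattrans_ext (C : preadditiveCat) (M N : cmod C) (s t : nattrans M N) :
  (forall X (a : M X), s X a = t X a) -> s = t.
Proof.
case: s t => [s s_nat] [t t_nat] /= st.
have {}st : s = t.
  by apply: functional_extensionality_dep => X; exact: additive_ext (st X).
by move: s_nat t_nat; rewrite st => p q; rewrite (Prop_irrelevance p q).
Qed.

Section Composition.
Variables (C : preadditiveCat) (L M N : cmod C).
Variables (t : nattrans M N) (s : nattrans L M).

Fact natcomp_naturality (X Y : C) (f : mor X Y) (a : L X) :
  (t Y \o s Y) (fmap L f a) = fmap N f ((t X \o s X) a).
Proof. by rewrite /= !naturality. Qed.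

Definition natcomp : nattrans L N :=
  @NatTrans C L N (fun X => t X \o s X : {additive _ -> _}) natcomp_naturality.

End Composition.

Definition epi (C : preadditiveCat) (M N : cmod C) (e : nattrans M N) : Prop :=
  forall (L : cmod C) (s t : nattrans N L), natcomp s e = natcomp t e -> s = t.

Definition projective (C : preadditiveCat) (P : cmod C) : Prop :=
  forall (M N : cmod C) (e : nattrans M N) (f : nattrans P N),
    epi e -> exists g : nattrans P M, natcomp e g = f.

Section Representable.
Variables (C : preadditiveCat) (A : C).

Definition postcomp (X Y : C) (f : mor X Y) (u : mor A X) : mor A Y := compm f u.

Fact postcomp_is_zmod_morphism (X Y : C) (f : mor X Y) :
  zmod_morphism (postcomp f).
Proof.
move=> u v; rewrite /postcomp; apply: (addIr (compm f v)).
by rewrite -compmDr !subrK.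
Qed.

HB.instance Definition _ (X Y : C) (f : mor X Y) :=
  GRing.isZmodMorphism.Build (mor A X) (mor A Y) (postcomp f)
    (postcomp_is_zmod_morphism f).

Definition homfunctor : cmod C :=
  @CMod C (fun X => mor A X) (fun X Y f => postcomp f : {additive _ -> _})
    (fun X u => compm1l u)
    (fun X Y Z g f u => esym (compmA g f u))
    (fun X Y f f' u => compmDl f f' u).

End Representable.

(* Main.v *)
Require Import Defs.
From HB Require Import structures.
From mathcomp Require Import all_boot ssralg finmap.
From mathcomp Require Import generic_quotient ring_quotient boolp.

Set Implicit Arguments.
Unset Strict Implicit.
Unset Printing Implicit Defensive.

Import GRing.Theory Quotient.

Local Open Scope fset_scope.
Local Open Scope ring_scope.

(** A functor is projective exactly when it is a retract of a free functor, that
    is, of a direct sum of representables, and dual bases are coordinates for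
    such retractions.

    A locally finite family of morphisms from P to the functors Hom(C_j, -) is
    the same thing as a single morphism s from P to their direct sum
    ([dsum_pair]).  By the Yoneda lemma, a family of elements x_j of P(C_j) is
    the same thing as a morphism r from this direct sum to P ([lincomb]).  Under
    this dictionary the dual basis formula reads r s = 1 ([lincombE]).

    If r s = 1, if e : M -> N is epi and f : P -> N, then e is pointwise
    surjective ([epi_surjective]), so each f(x_j) lifts to some y_j in M(C_j).
    The elements y_j define a morphism g from the direct sum to M.  Both e g and
    f r take the j-th generator to f(x_j), so they agree ([lincomb_nat]); hence
    e g s = f r s = f, and g s lifts f.

    Conversely, let the x_j run over all elements of all the groups P(Y).  The
    corresponding r is pointwise surjective, hence epi ([surjective_epi]), and
    projectivity lifts the identity of P to a section s of r; the coordinates of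
    s form a dual basis. *)

(** * Epimorphisms are the pointwise surjections *)

Lemma surjective_epi (C : preadditiveCat) (M N : cmod C) (e : nattrans M N) :
  (forall (X : C) (b : N X), exists a : M X, e X a = b) -> epi e.
Proof.
move=> e_surj L s t st; apply: nattrans_ext => X b.
have [a <-] := e_surj X b.
exact: (congr1 (fun u : nattrans M L => u X a) st).
Qed.

Section Cokernel.
Variables (C : preadditiveCat) (M N : cmod C) (e : nattrans M N).

Definition im (X : C) : pred (N X) := fun b => `[< exists a, e X a = b >].

Fact im_zmod_closed (X : C) : zmod_closed (@im X).
Proof.
split; first by apply/asboolP; exists 0; rewrite raddf0.
move=> _ _ /asboolP[a <-] /asboolP[b <-]; apply/asboolP.
by exists (a - b); rewrite raddfB.
Qed.

HB.instance Definition _ (X : C) :=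
  GRing.isZmodClosed.Build (N X) (@im X) (@im_zmod_closed X).

Definition im_closed (X : C) : zmodClosed (N X) :=
  GRing.ZmodClosed.clone (N X) (@im X) _.

(** The cokernel of e is the pointwise quotient by the image, a subfunctor of N
    by naturality of e. *)
Definition coker_ob (X : C) : zmodType := {quot (im_closed X)}.

Definition coker_proj (X : C) : {additive N X -> coker_ob X} :=
  \pi_({quot (im_closed X)})%qT.

Lemma coker_projP (X : C) (b b' : N X) :
  coker_proj X b = coker_proj X b' <-> exists a, e X a = b - b'.
Proof.
have -> : (exists a, e X a = b - b') <-> (b - b' \in im_closed X).
  by split=> [?|/asboolP//]; apply/asboolP.
rewrite idealrBE; split=> [/eqP//|/eqP//].
Qed.

Lemma coker_projK (X : C) (q : coker_ob X) : coker_proj X (repr q) = q.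
Proof. exact: reprK. Qed.

(** The induced map is computed on a representative; [coker_mapE] shows that any
    other representative gives the same class. *)
Definition coker_map (X Y : C) (f : mor X Y) (q : coker_ob X) : coker_ob Y :=
  coker_proj Y (fmap N f (repr q)).

Lemma coker_mapE (X Y : C) (f : mor X Y) (b : N X) :
  coker_map f (coker_proj X b) = coker_proj Y (fmap N f b).
Proof.
apply/coker_projP; rewrite -raddfB.
have /coker_projP[a <-] := coker_projK (coker_proj X b).
by exists (fmap M f a); rewrite naturality.
Qed.

Fact coker_map_zmod_morphism (X Y : C) (f : mor X Y) :
  zmod_morphism (coker_map f).
Proof.
move=> q q'; rewrite -[q]coker_projK -[q']coker_projK -raddfB !coker_mapE.
by rewrite !raddfB.
Qed.

HB.instance Definition _ (X Y : C) (f : mor X Y) :=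
  GRing.isZmodMorphism.Build (coker_ob X) (coker_ob Y) (coker_map f)
    (coker_map_zmod_morphism f).

Fact coker_map_id (X : C) (q : coker_ob X) : coker_map (idm X) q = q.
Proof. by rewrite -[q]coker_projK coker_mapE fmap_id. Qed.

Fact coker_map_comp (X Y Z : C) (g : mor Y Z) (f : mor X Y) (q : coker_ob X) :
  coker_map (compm g f) q = coker_map g (coker_map f q).
Proof. by rewrite -[q]coker_projK !coker_mapE fmap_comp. Qed.

Fact coker_mapD (X Y : C) (f f' : mor X Y) (q : coker_ob X) :
  coker_map (f + f') q = coker_map f q + coker_map f' q.
Proof. by rewrite -[q]coker_projK !coker_mapE fmapD raddfD. Qed.

Definition coker : cmod C :=
  @CMod C coker_ob (fun X Y f => coker_map f : {additive _ -> _})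
    coker_map_id coker_map_comp coker_mapD.

Definition to_coker : nattrans N coker :=
  @NatTrans C N coker coker_proj (fun X Y f b => esym (coker_mapE f b)).

End Cokernel.

Section ZeroTransformation.
Variables (C : preadditiveCat) (M N : cmod C).

Fact nat0_naturality (X Y : C) (f : mor X Y) (a : M X) :
  (\0 : M Y -> N Y) (fmap M f a) = fmap N f ((\0 : M X -> N X) a).
Proof. by rewrite /= raddf0. Qed.

Definition nat0 : nattrans M N :=
  @NatTrans C M N (fun X => \0 : {additive _ -> _}) nat0_naturality.

End ZeroTransformation.

(** An epimorphism cannot distinguish the projection onto its cokernel from
    zero, so the cokernel vanishes at every object. *)
Lemma epi_surjective (C : preadditiveCat) (M N : cmod C) (e : nattrans M N) :
  epi e -> forall (X : C) (b : N X), exists a : M X, e X a = b.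
Proof.
move=> epi_e X b.
have proj0 : to_coker e = nat0 N (coker e).
  apply: epi_e; apply: nattrans_ext => Y a /=.
  rewrite -[RHS](raddf0 (coker_proj e Y)); apply/coker_projP.
  by exists a; rewrite subr0.
have : coker_proj e X b = coker_proj e X 0.
  rewrite raddf0.
  exact: (congr1 (fun t : nattrans N (coker e) => t X b) proj0).
by move=> /coker_projP; rewrite subr0.
Qed.

(** * Direct sums *)

Section DirectSum.
Variables (J : choiceType).

Record dsum (V : J -> zmodType) := DSum {
  coord :> forall j, V j;
  coord_finite : exists A : {fset J}, forall j, j \notin A -> coord j = 0
}.

HB.instance Definition _ (V : J -> zmodType) := gen_eqMixin (dsum V).
HB.instance Definition _ (V : J -> zmodType) := gen_choiceMixin (dsum V).

Definition support_of (V : J -> zmodType) (u : dsum V) : {fset J} :=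
  projT1 (cid (coord_finite u)).

Lemma support_ofP (V : J -> zmodType) (u : dsum V) (j : J) :
  j \notin support_of u -> u j = 0.
Proof. exact: projT2 (cid (coord_finite u)) j. Qed.

Lemma dsum_ext (V : J -> zmodType) (u v : dsum V) :
  (forall j, u j = v j) -> u = v.
Proof.
case: u v => [u u_fin] [v v_fin] /= uv.
have {}uv : u = v by apply: functional_extensionality_dep.
by move: u_fin v_fin; rewrite uv => p q; rewrite (Prop_irrelevance p q).
Qed.

Section Group.
Variable V : J -> zmodType.
Implicit Types u v : dsum V.

Fact dsum0_finite : exists A : {fset J}, forall j, j \notin A -> (0 : V j) = 0.
Proof. by exists fset0. Qed.

Definition dsum0 : dsum V := DSum dsum0_finite.

Fact dsum_opp_finite u :
  exists A : {fset J}, forall j, j \notin A -> - u j = 0.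
Proof. by exists (support_of u) => j /support_ofP ->; rewrite oppr0. Qed.

Definition dsum_opp u : dsum V := DSum (dsum_opp_finite u).

Fact dsum_add_finite u v :
  exists A : {fset J}, forall j, j \notin A -> u j + v j = 0.
Proof.
exists (support_of u `|` support_of v) => j; rewrite in_fsetU negb_or.
by case/andP=> /support_ofP -> /support_ofP ->; rewrite addr0.
Qed.

Definition dsum_add u v : dsum V := DSum (dsum_add_finite u v).

Fact dsum_addA : associative dsum_add.
Proof. by move=> u v w; apply: dsum_ext => j; exact: addrA. Qed.

Fact dsum_addC : commutative dsum_add.
Proof. by move=> u v; apply: dsum_ext => j; exact: addrC. Qed.

Fact dsum_add0 : left_id dsum0 dsum_add.
Proof. by move=> u; apply: dsum_ext => j; exact: add0r. Qed.

Fact dsum_addN : left_inverse dsum0 dsum_opp dsum_add.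
Proof. by move=> u; apply: dsum_ext => j; exact: addNr. Qed.

HB.instance Definition _ := GRing.isZmodule.Build (dsum V)
  dsum_addA dsum_addC dsum_add0 dsum_addN.

End Group.

Section Copairing.
Variables (V : J -> zmodType) (W : zmodType) (g : forall j, {additive V j -> W}).

Definition dsum_copair (u : dsum V) : W := \sum_(j <- support_of u) g j (u j).

(** The sum may be taken over any finite set outside which the coordinates
    vanish, because the extra terms are zero.  Additivity and naturality rest on
    this freedom, as a sum u - v or an image of u has a chosen
    support of its own, unrelated to those of u and v. *)
Lemma dsum_copairE (u : dsum V) (A : {fset J}) :
  (forall j, j \notin A -> u j = 0) ->
  dsum_copair u = \sum_(j <- A) g j (u j).
Proof.
move=> uA.
(* Both sums equal the sum over a common larger set D. *)
have sub0 (B : {fset J}) : (forall j, j \notin B -> u j = 0) ->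
    \sum_(j <- B) g j (u j) = \sum_(j <- support_of u `|` A) g j (u j).
  move=> uB; pose D := B `|` (support_of u `|` A).
  transitivity (\sum_(j <- D) g j (u j)).
    apply: big_fset_incl; first exact: fsubsetUl.
    by move=> j _ /uB ->; rewrite raddf0.
  apply/esym/big_fset_incl; first exact: fsubsetUr.
  move=> j _; rewrite in_fsetU negb_or => /andP[_ /uA ->].
  by rewrite raddf0.
by rewrite /dsum_copair sub0 ?(sub0 A) //; exact: support_ofP.
Qed.

Fact dsum_copair_zmod_morphism : zmod_morphism dsum_copair.
Proof.
move=> u v; pose A := support_of u `|` support_of v.
have uA j : j \notin A -> u j = 0.
  by rewrite in_fsetU negb_or => /andP[/support_ofP].
have vA j : j \notin A -> v j = 0.
  by rewrite in_fsetU negb_or => /andP[_ /support_ofP].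
have uvA j : j \notin A -> (u - v) j = 0.
  by move=> jA /=; rewrite uA ?vA ?subrr.
rewrite (dsum_copairE uA) (dsum_copairE vA) (dsum_copairE uvA) -sumrB.
by apply: eq_bigr => j _; rewrite -raddfB.
Qed.

HB.instance Definition _ :=
  GRing.isZmodMorphism.Build (dsum V) W dsum_copair dsum_copair_zmod_morphism.

End Copairing.

Section Single.
Variables (V : J -> zmodType) (i : J) (a : V i).

(** The value at j = i has to be transported from V i to V j; by uniqueness of
    identity proofs this transport is trivial at i itself. *)
Definition single_coord (j : J) : V j :=
  match i =P j with
  | ReflectT ij => ecast k (V k) ij a
  | ReflectF _ => 0
  end.

Lemma single_off (j : J) : j \notin [fset i] -> single_coord j = 0.
Proof.
rewrite in_fset1 /single_coord => ji.
by case: eqP => // ij; rewrite ij eqxx in ji.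
Qed.

Definition single : dsum V :=
  DSum (ex_intro (fun A : {fset J} => forall j, j \notin A -> _ = 0)
    [fset i] single_off).

Lemma single_diag : single i = a.
Proof.
by rewrite /= /single_coord; case: eqP => // ii; rewrite eq_axiomK.
Qed.

End Single.

Section Functor.
Variables (C : preadditiveCat) (F : J -> cmod C).

Definition dsum_ob (X : C) : zmodType := dsum (fun j => F j X).

Fact dsum_map_finite (X Y : C) (f : mor X Y) (u : dsum_ob X) :
  exists A : {fset J}, forall j, j \notin A -> fmap (F j) f (coord u j) = 0.
Proof. by exists (support_of u) => j /support_ofP ->; rewrite raddf0. Qed.

Definition dsum_map (X Y : C) (f : mor X Y) (u : dsum_ob X) : dsum_ob Y :=
  DSum (dsum_map_finite f u).

Fact dsum_map_zmod_morphism (X Y : C) (f : mor X Y) :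
  zmod_morphism (dsum_map f).
Proof.
by move=> u v; apply: dsum_ext => j; exact: (raddfB (fmap (F j) f)).
Qed.

HB.instance Definition _ (X Y : C) (f : mor X Y) :=
  GRing.isZmodMorphism.Build (dsum_ob X) (dsum_ob Y) (dsum_map f)
    (dsum_map_zmod_morphism f).

Fact dsum_map_id (X : C) (u : dsum_ob X) : dsum_map (idm X) u = u.
Proof. by apply: dsum_ext => j; exact: fmap_id. Qed.

Fact dsum_map_comp (X Y Z : C) (g : mor Y Z) (f : mor X Y) (u : dsum_ob X) :
  dsum_map (compm g f) u = dsum_map g (dsum_map f u).
Proof. by apply: dsum_ext => j; exact: fmap_comp. Qed.

Fact dsum_mapD (X Y : C) (f f' : mor X Y) (u : dsum_ob X) :
  dsum_map (f + f') u = dsum_map f u + dsum_map f' u.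
Proof. by apply: dsum_ext => j; exact: fmapD. Qed.

Definition dsum_cmod : cmod C :=
  @CMod C dsum_ob (fun X Y f => dsum_map f : {additive _ -> _})
    dsum_map_id dsum_map_comp dsum_mapD.

Section NaturalCopairing.
Variables (M : cmod C) (t : forall j, nattrans (F j) M).

Fact dsum_copair_naturality (X Y : C) (f : mor X Y) (u : dsum_ob X) :
  dsum_copair (fun j => t j Y) (dsum_map f u) =
  fmap M f (dsum_copair (fun j => t j X) u).
Proof.
have fu_supp j : j \notin support_of u -> dsum_map f u j = 0.
  by move=> ju /=; rewrite support_ofP // raddf0.
rewrite (dsum_copairE _ fu_supp) /dsum_copair raddf_sum.
by apply: eq_bigr => j _; rewrite -naturality.
Qed.

Definition dsum_copair_nat : nattrans dsum_cmod M :=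
  @NatTrans C dsum_cmod M
    (fun X => dsum_copair (fun j => t j X) : {additive _ -> _})
    dsum_copair_naturality.

End NaturalCopairing.

Section Coordinate.
Variable j : J.

Definition dsum_coord (X : C) (u : dsum_ob X) : F j X := u j.

Fact dsum_coord_zmod_morphism (X : C) : zmod_morphism (@dsum_coord X).
Proof. by []. Qed.

HB.instance Definition _ (X : C) :=
  GRing.isZmodMorphism.Build (dsum_ob X) (F j X) (@dsum_coord X)
    (@dsum_coord_zmod_morphism X).

Definition dsum_coord_nat : nattrans dsum_cmod (F j) :=
  @NatTrans C dsum_cmod (F j) (fun X => @dsum_coord X : {additive _ -> _})
    (fun X Y f u => erefl).

End Coordinate.

(** Only a locally finite family of morphisms into the summands, which a priori
    defines a morphism into the product, has its values in the direct sum. *)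
Section NaturalPairing.
Variables (P : cmod C) (s : forall j, nattrans P (F j)).
Hypothesis s_finite : forall (X : C) (a : P X),
  exists A : {fset J}, forall j, j \notin A -> s j X a = 0.

Definition dsum_pair (X : C) (a : P X) : dsum_ob X := DSum (s_finite a).

Fact dsum_pair_zmod_morphism (X : C) : zmod_morphism (@dsum_pair X).
Proof. by move=> a b; apply: dsum_ext => j; exact: (raddfB (s j X)). Qed.

HB.instance Definition _ (X : C) :=
  GRing.isZmodMorphism.Build (P X) (dsum_ob X) (@dsum_pair X)
    (@dsum_pair_zmod_morphism X).

Fact dsum_pair_naturality (X Y : C) (f : mor X Y) (a : P X) :
  dsum_pair (fmap P f a) = dsum_map f (dsum_pair a).
Proof. by apply: dsum_ext => j; exact: naturality. Qed.

Definition dsum_pair_nat : nattrans P dsum_cmod :=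
  @NatTrans C P dsum_cmod (fun X => @dsum_pair X : {additive _ -> _})
    dsum_pair_naturality.

End NaturalPairing.

End Functor.

End DirectSum.

(** * Free functors *)

Section Yoneda.
Variables (C : preadditiveCat) (M : cmod C) (A : C) (y : M A).

Definition yoneda_eval (X : C) (u : mor A X) : M X := fmap M u y.

Fact yoneda_eval_zmod_morphism (X : C) : zmod_morphism (@yoneda_eval X).
Proof.
move=> u v; rewrite /yoneda_eval; apply: (addIr (fmap M v y)).
by rewrite -fmapD !subrK.
Qed.

HB.instance Definition _ (X : C) :=
  GRing.isZmodMorphism.Build (mor A X) (M X) (@yoneda_eval X)
    (@yoneda_eval_zmod_morphism X).

(** The morphism corresponding to y in M(A) under the Yoneda lemma. *)
Definition yoneda : nattrans (homfunctor A) M :=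
  @NatTrans C (homfunctor A) M
    (fun X => @yoneda_eval X : {additive _ -> _})
    (fun X Y f u => fmap_comp f u y).

End Yoneda.

Section Free.
Variables (C : preadditiveCat) (J : choiceType) (c : J -> C).

Definition free_cmod : cmod C := dsum_cmod (fun j => homfunctor (c j)).

Definition lincomb (M : cmod C) (y : forall j, M (c j)) :
  nattrans free_cmod M := dsum_copair_nat (fun j => yoneda (y j)).

Lemma lincombE (M : cmod C) (y : forall j, M (c j)) (X : C)
    (u : free_cmod X) (A : {fset J}) :
  (forall j, j \notin A -> coord u j = 0) ->
  lincomb y X u = \sum_(j <- A) fmap M (coord u j) (y j).
Proof. exact: dsum_copairE. Qed.

(** Morphisms preserve linear combinations; this is what turns a lift of the
    elements x_j along an epimorphism into a lift of a morphism. *)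
Lemma lincomb_nat (M N : cmod C) (t : nattrans M N) (y : forall j, M (c j))
    (X : C) (u : free_cmod X) :
  t X (lincomb y X u) = lincomb (fun j => t (c j) (y j)) X u.
Proof.
rewrite !(lincombE _ (@support_ofP _ _ u)) raddf_sum.
by apply: eq_bigr => j _; rewrite naturality.
Qed.

Lemma lincomb_basis (M : cmod C) (y : forall j, M (c j)) (j : J) :
  exists u : free_cmod (c j), lincomb y (c j) u = y j.
Proof.
pose u : free_cmod (c j) :=
  single (V := fun k => mor (c k) (c j)) (idm (c j)).
exists u; rewrite (lincombE y (u := u) (single_off _)) big_seq_fset1.
by rewrite single_diag fmap_id.
Qed.

End Free.

Section NatId.
Variables (C : preadditiveCat) (P : cmod C).

Definition natid : nattrans P P :=
  @NatTrans C P P (fun X => idfun : {additive _ -> _}) (fun X Y f a => erefl).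

End NatId.

(** * The dual basis lemma *)

(* J_{X,a} = A contains every j with [beta_j]_X(a) <> 0, as in the dual basis
   lemma for modules.  Without that clause the "if" direction fails: take for C
   the ring Z (one object) and for P the group Z^N, where every a is a multiple
   beta(a) b of some b, for some integral linear form beta. *)
Theorem proposition6p1 (C : preadditiveCat) (P : cmod C) :
  projective P <->
  exists (J : choiceType) (c : J -> C)
         (beta : forall j : J, nattrans P (homfunctor (c j)))
         (x : forall j : J, P (c j)),
  forall (X : C) (a : P X), exists A : {fset J},
    (forall j : J, j \notin A -> beta j X a = 0) /\
    a = \sum_(j <- A) fmap P (beta j X a) (x j).
Proof.
split=> [projP | [J [c [beta [x dual]]]] M N e f /epi_surjective e_surj].
- (* Every element of P occurs in this family. *)
  pose J : choiceType := {classic {Y : C & P Y}}.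
  pose c (j : J) : C := projT1 j.
  pose x (j : J) : P (c j) := projT2 j.
  have r_surj (X : C) (a : P X) : exists u, lincomb x X u = a.
    exact: (lincomb_basis x (existT _ X a : J)).
  have [s rs] := projP _ _ _ (natid P) (surjective_epi r_surj).
  exists J, c, (fun j => natcomp (dsum_coord_nat _ j) s), x => X a.
  exists (support_of (s X a)); split; first exact: support_ofP.
  rewrite -(lincombE x (@support_ofP _ _ (s X a))).
  exact: (esym (congr1 (fun t : nattrans P P => t X a) rs)).
- have beta_finite X (a : P X) :
      exists A : {fset J}, forall j, j \notin A -> beta j X a = 0.
    by have [A [betaA _]] := dual X a; exists A.
  pose s := dsum_pair_nat beta_finite.
  have rs X (a : P X) : lincomb x X (s X a) = a.
    have [A [betaA aE]] := dual X a.
    by rewrite (lincombE x (A := A)) -?aE.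
  have lift j : {y : M (c j) | e (c j) y = f (c j) (x j)}.
    exact: cid (e_surj _ _).
  exists (natcomp (lincomb (fun j => sval (lift j))) s).
  (* Both sides become the linear combinations with coordinates s(a) of the
     same elements e(y_j) = f(x_j). *)
  apply: nattrans_ext => X a; rewrite -[in RHS](rs X a) /=.
  rewrite !lincomb_nat; congr (lincomb _ X _).
  by apply: functional_extensionality_dep => j; exact: svalP (lift j).
Qed.
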